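(* Let $k$ be an algebraically closed field of characteristic $p>0$ and let $n\geq 1$. Let $X\subset \mathbb{P}^n_k$ be a finite nonempty set of distinct points, with defining ideal $I=I(X)\subset S=k[x_0,\ldots,x_n]$. Then for every integer $m\geq 1$, $$\widehat{\alpha}(I)\geq \frac{\alpha(I^{(m)})+n-1}{m+n-1}.$$
   Context: $S=k[x_0,\ldots,x_n]$ is the standard graded polynomial ring and $I(X)$ is the homogeneous ideal of all polynomials vanishing on $X$. For a nonzero homogeneous ideal $L\subseteq S$, its initial degree is $\alpha(L)=\min\{d\mid L_d\neq 0\}$, where $L_d$ is the degree-$d$ graded piece. If $X=\{Q_1,\ldots,Q_s\}$ and $I(Q_i)$ is the homogeneous ideal of the point $Q_i$, then for $r\ge 1$ the $r$-th symbolic power of $I=I(X)$ is $I^{(r)}=\bigcap_{i=1}^s I(Q_i)^r$. The Waldschmidt constant of $I$ is $\widehat{\alpha}(I)=\lim_{r\to\infty}\alpha(I^{(r)})/r$; the limit exists by subadditivity of $r\mapsto\alpha(I^{(r)})$ (Fekete's lemma). *)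

(* Defs.v *)
From HB Require Import structures.
From mathcomp Require Import all_boot all_order all_algebra.
From mathcomp Require Import boolp classical_sets functions cardinality.
From mathcomp Require Import reals topology normedtype sequences.
(* The notations of mpoly clash with those of mathcomp-analysis; the ones
   needed are restated below. *)
From mathcomp Require Import -(notations) mpoly.

Set Implicit Arguments.
Unset Strict Implicit.
Unset Printing Implicit Defensive.

Import Order.TTheory GRing.Theory Num.Theory.
Import numFieldNormedType.Exports.

Local Open Scope classical_set_scope.
Local Open Scope ring_scope.

Notation "{ 'mpoly' T [ n ] }" := (mpoly n T)
  (at level 0, T at level 2, n at level 9, format "{ 'mpoly'  T [ n ] }").
Notation "d .-homog" := (@ishomog1 _ _ d mdeg)
  (at level 1, format "d .-homog") : form_scope.

(* Points of P^n are the lines through the origin of k^(n+1); the homogeneous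
   coordinate vectors of a point are the nonzero vectors of its line. *)
Definition projective_space (k : fieldType) (n : nat) :=
  {L : {vspace 'rV[k]_n.+1} | \dim L == 1%N}.

Definition vanishes_at (k : fieldType) (n : nat)
    (f : {mpoly k[n.+1]}) (Q : projective_space k n) : Prop :=
  forall v : 'rV[k]_n.+1, v \in val Q -> v != 0 -> meval (v ord0) f = 0.

Definition vanishing_ideal (k : fieldType) (n : nat)
    (X : set (projective_space k n)) : set {mpoly k[n.+1]} :=
  [set f | forall Q, X Q -> vanishes_at f Q].

(* The ideal generated by the r-fold products of elements of J; for r = 0 this
   is the unit ideal. *)
Definition ideal_power (A : comNzRingType) (J : set A) (r : nat) : set A :=
  [set f | exists (N : nat) (c : 'I_N -> A) (g : 'I_N -> 'I_r -> A),
     (forall j i, J (g j i)) /\ f = \sum_(j < N) c j * \prod_(i < r) g j i].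

Definition symbolic_power (k : fieldType) (n : nat)
    (X : set (projective_space k n)) (r : nat) : set {mpoly k[n.+1]} :=
  \bigcap_(Q in X) ideal_power (vanishing_ideal [set Q]) r.

Definition graded_piece (k : fieldType) (n : nat)
    (L : set {mpoly k[n]}) (d : nat) : set {mpoly k[n]} :=
  [set f | L f /\ f \is d.-homog].

Definition nonzero_degrees (k : fieldType) (n : nat)
    (L : set {mpoly k[n]}) : set nat :=
  [set d | exists2 f, graded_piece L d f & f != 0].

(* The least element of nonzero_degrees L, with junk value 0 when that set is
   empty. *)
Definition initial_degree (k : fieldType) (n : nat)
    (L : set {mpoly k[n]}) : nat :=
  xget 0%N [set d | nonzero_degrees L d /\
                    forall e, nonzero_degrees L e -> (d <= e)%N].

(* The term at r = 0 is a division by zero and does not affect the limit. *)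
Definition waldschmidt_constant (R : realType) (k : fieldType) (n : nat)
    (X : set (projective_space k n)) : R :=
  limn (fun r : nat => (initial_degree (symbolic_power X r))%:R / r%:R : R).

(* Main.v *)
Require Import Defs.
From mathcomp Require Import all_boot all_order all_algebra.
From mathcomp Require Import classical_sets cardinality reals.
From mathcomp Require Import boolp topology normedtype sequences zify lra.
From mathcomp Require Import -(notations) mpoly.

(** Write alpha r for the least degree of a nonzero form in I^(r).  The proof
    compares alpha (q * (m + n - 1)) with alpha m for q a power of p, and shows
      q * (alpha m + n - 1) <= alpha (q * (m + n - 1)).
    Dividing by q * (m + n - 1) and letting q grow gives the bound, since the
    sequence alpha r / r converges by subadditivity.

    The inequality comes from Frobenius.  Let N = q * (m + n - 1), and let f be
    a nonzero form of degree d in I^(N).  As k is perfect, f is uniquely a sum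
    of terms g_l ^ q * x^l, with all entries of the exponent l below q
    (frob_part).  Near a point of X, choose an affine chart centred there,
    at v; in it f is a sum of terms g_l ^ q * (v + y)^l.  If B bounds the total exponent
    of those (v + y)^l, the coefficient of f at an exponent q * b + c with all
    entries of c below q only involves the coefficients of the g_l at b.  Thus
    the vanishing of f to order N kills the coefficients of every g_l at
    those b with q * |b| + B < N (frob_part_order): each g_l vanishes to order
    about (N - B) / q.

    Take l of largest total degree M among the exponents that occur, so
    d = q * deg g_l + M.  Two choices of B are available: n * (q - 1), as a
    chart has n coordinates, and M.
    - If M >= q * (n - 1), the first one puts g_l in I^(m), so that
      d >= q * alpha m + q * (n - 1).
    - If M < q * (n - 1), put t = M %/ q; the second one puts g_l in
      I^(m + n - 1 - t).  As alpha increases strictly, deg g_l is at least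
      alpha m + n - 1 - t, and d >= q * (alpha m + n - 1 - t) + q * t.

    Strict growth of alpha is clear in characteristic 0 by differentiating a
    form.  Here all derivatives of f vanish when f is a p-th power g ^ p; in
    that case a form g' of degree one less than g, found by induction, gives
    g ^ (p - 1) * g' in place of a derivative (descend_fat_form). *)

Set Implicit Arguments.
Unset Strict Implicit.
Unset Printing Implicit Defensive.

Import Order.TTheory GRing.Theory Num.Theory.
Import numFieldNormedType.Exports.

Local Open Scope classical_set_scope.
Local Open Scope ring_scope.

Local Notation "[ 'mnm' E | i < n ]" :=
  (@Multinom _ [tuple E%N | i < n]) (at level 0, i, n at level 2).
Local Delimit Scope multi_scope with MM.
Local Notation "0" := (@mnm0 _) : multi_scope.
Local Notation "m1 + m2" := (mnm_add m1 m2) : multi_scope.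
Local Notation "m *+ q" := (mnm_muln m q) : multi_scope.
Local Notation "''X_[' m ]" := (mpolyX _ m) (at level 8, format "''X_[' m ]").
Local Notation "''X_' i" := (mpolyX _ (mnm1 i))
  (at level 8, i at level 2, format "''X_' i").
Local Notation "p @_ m" := (mcoeff m p) (at level 3, m at level 2, format "p @_ m").
Local Notation "c %:MP" := (mpolyC _ c) (at level 2, format "c %:MP").
Local Notation "p \mPo lq" := (comp_mpoly lq p) (at level 50).
Local Notation "p ^`M ( i )" := (mderiv i p) (at level 8, format "p ^`M ( i )").

(** * Powers of an ideal *)

Section IdealPowers.

Variables (A : comNzRingType) (J : set A).

Lemma ideal_power_prod r (g : 'I_r -> A) :
  (forall i, J (g i)) -> ideal_power J r (\prod_(i < r) g i).
Proof.
move=> Jg; exists 1%N, (fun=> 1), (fun=> g); split=> //.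
by rewrite big_ord1 mul1r.
Qed.

Lemma ideal_powerMl r c f : ideal_power J r f -> ideal_power J r (c * f).
Proof.
move=> [N [b [g [Jg ->]]]]; exists N, (fun j => c * b j), g; split=> //.
by rewrite mulr_sumr; apply: eq_bigr => j _; rewrite mulrA.
Qed.

Lemma ideal_power0 r : ideal_power J r 0.
Proof.
exists 0%N, (fun=> 0), (fun _ _ => 0).
by split=> [[]//|]; rewrite big_ord0.
Qed.

Lemma ideal_powerD r f1 f2 :
  ideal_power J r f1 -> ideal_power J r f2 -> ideal_power J r (f1 + f2).
Proof.
move=> [N1 [c1 [g1 [Jg1 ->]]]] [N2 [c2 [g2 [Jg2 ->]]]].
exists (N1 + N2)%N, (fun j => match split j with inl a => c1 a | inr a => c2 a end),
  (fun j => match split j with inl a => g1 a | inr a => g2 a end).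
split=> [j i|]; first by case: (split j) => a.
rewrite big_split_ord /=; congr (_ + _); apply: eq_bigr => j _.
  by rewrite (unsplitK (inl j)).
by rewrite (unsplitK (inr j)).
Qed.

Lemma ideal_power_sum r I (s : seq I) (P : pred I) (F : I -> A) :
  (forall i, P i -> ideal_power J r (F i)) ->
  ideal_power J r (\sum_(i <- s | P i) F i).
Proof.
by move=> JF; apply: big_ind => //; [exact: ideal_power0 | exact: ideal_powerD].
Qed.

Lemma ideal_powerS r x f : J x -> ideal_power J r f -> ideal_power J r.+1 (x * f).
Proof.
move=> Jx [N [c [g [Jg ->]]]]; rewrite mulr_sumr; apply: ideal_power_sum => j _.
rewrite mulrCA; apply: ideal_powerMl.
pose h (i : 'I_r.+1) := if unlift ord0 i is Some i' then g j i' else x.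
have -> : x * \prod_(i < r) g j i = \prod_(i < r.+1) h i.
  rewrite big_ord_recl /h unlift_none; congr (_ * _).
  by apply: eq_bigr => i _; rewrite liftK.
by apply: ideal_power_prod => i; rewrite /h; case: unlift.
Qed.

Lemma ideal_powerXn r x : J x -> ideal_power J r (x ^+ r).
Proof.
move=> Jx; rewrite -[r in x ^+ r]card_ord -prodr_const.
exact: ideal_power_prod.
Qed.

(** The form in which membership of a monomial in the w i is recognized: only
    its total degree counts. *)
Lemma ideal_power_prodX r I (s : seq I) (w : I -> A) (e : I -> nat) :
  (forall i, J (w i)) -> (r <= \sum_(i <- s) e i)%N ->
  ideal_power J r (\prod_(i <- s) w i ^+ e i).
Proof.
move=> Jw; elim: s r => [|i s IH] r.
  rewrite !big_nil leqn0 => /eqP ->.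
  exists 1%N, (fun=> 1), (fun _ _ => 0); split=> [j []//|].
  by rewrite big_ord1 big_ord0 mulr1.
rewrite !big_cons.
elim: (e i) r => [|a IHa] [|r] le_r; rewrite ?expr0 ?mul1r; try exact: IH.
  by rewrite exprS -mulrA; apply: ideal_powerMl; exact: IHa.
by rewrite exprS -mulrA; apply: ideal_powerS => //; exact: IHa.
Qed.

End IdealPowers.

Section Derivation.

Variables (R : comNzRingType) (n : nat) (J : set {mpoly R[n]}) (j : 'I_n).

(** Leibniz: differentiating a product of r + 1 factors leaves r of them
    untouched in each term. *)
Lemma ideal_power_deriv r f : ideal_power J r.+1 f -> ideal_power J r f^`M(j).
Proof.
have prod_deriv : forall s (g : 'I_s.+1 -> {mpoly R[n]}), (forall i, J (g i)) ->
    ideal_power J s (\prod_(i < s.+1) g i)^`M(j).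
  elim=> [|s IHs] g Jg.
    by rewrite big_ord1 -[_^`M(_)]mulr1; apply: ideal_powerMl;
       have := @ideal_power_prod _ J 0 (fun=> 0); rewrite big_ord0; apply; case.
  rewrite big_ord_recl mderivM; apply: ideal_powerD.
    by apply: ideal_powerMl; exact: ideal_power_prod.
  by apply: ideal_powerS => //; exact: IHs.
move=> [N [c [g [Jg ->]]]]; rewrite raddf_sum; apply: ideal_power_sum => a _ /=.
rewrite mderivM; apply: ideal_powerD.
  rewrite big_ord_recl mulrA; apply: ideal_powerMl; exact: ideal_power_prod.
by apply: ideal_powerMl; exact: prod_deriv.
Qed.

End Derivation.

(** * Order of vanishing at the origin *)

Section Order.

Variables (R : comNzRingType) (n : nat).
Implicit Types (p q : {mpoly R[n]}).

(** Vanishing to order r at the origin, that is, membership in the r-th power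
    of the ideal of the origin. *)
Definition order_ge r p := forall m, (mdeg m < r)%N -> p@_m = 0.

Lemma order_geD r p q : order_ge r p -> order_ge r q -> order_ge r (p + q).
Proof. by move=> hp hq m lt_m; rewrite mcoeffD hp ?hq ?addr0. Qed.

Lemma order_ge_sum r I (s : seq I) (F : I -> {mpoly R[n]}) :
  (forall i, order_ge r (F i)) -> order_ge r (\sum_(i <- s) F i).
Proof.
by move=> hF; apply: big_ind => //; [move=> m _; rewrite mcoeff0 | exact: order_geD].
Qed.

Lemma order_geM r s p q : order_ge r p -> order_ge s q -> order_ge (r + s) (p * q).
Proof.
move=> hp hq m lt_m; rewrite mcoeffM big1 // => -[k1 k2] /= /eqP def_m.
have [lt1|ge1] := ltnP (mdeg k1) r; first by rewrite hp ?mul0r.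
by rewrite hq ?mulr0 //; have := congr1 mdeg def_m; rewrite mdegD; lia.
Qed.

Lemma order_ge_prod I (s : seq I) (e : I -> nat) (F : I -> {mpoly R[n]}) :
  (forall i, order_ge (e i) (F i)) ->
  order_ge (\sum_(i <- s) e i) (\prod_(i <- s) F i).
Proof.
move=> hF; elim: s => [|i s IHs]; first by rewrite big_nil.
by rewrite !big_cons; exact: order_geM.
Qed.

Lemma order_ge_leq r s p : (s <= r)%N -> order_ge r p -> order_ge s p.
Proof. by move=> le_sr hp m lt_m; apply: hp; exact: leq_trans lt_m le_sr. Qed.

End Order.

(** * Affine charts *)

Lemma comp_mpoly_comp (R : comNzRingType) n a b (p : {mpoly R[n]})
    (la : n.-tuple {mpoly R[a]}) (lb : a.-tuple {mpoly R[b]}) :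
  (p \mPo la) \mPo lb = p \mPo [tuple tnth la j \mPo lb | j < n].
Proof.
rewrite (comp_mpolyE p la) (comp_mpolyE p) raddf_sum; apply: eq_bigr => m _ /=.
rewrite linearZ rmorph_prod; congr (_ *: _); apply: eq_bigr => j _ /=.
by rewrite rmorphXn tnth_mktuple.
Qed.

Section Chart.

Variables (k : fieldType) (n : nat) (i : 'I_n).

(** Exponents after setting the i-th variable to 1. *)
Definition mnm_drop (m : multinom n) := [mnm (if j == i then 0 else m j) | j < n].

Lemma mdeg_drop m : mdeg m = (m i + mdeg (mnm_drop m))%N.
Proof.
rewrite !mdegE (bigD1 i) //= (bigD1 (P := xpredT) i) //= mnmE eqxx add0n.
by congr (_ + _)%N; apply: eq_bigr => j /negbTE ji; rewrite mnmE ji.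
Qed.

Lemma mnm_drop_inj m1 m2 : mnm_drop m1 = mnm_drop m2 -> m1 i = m2 i -> m1 = m2.
Proof.
move=> eq_d eq_i; apply/mnmP => j; have [->//|ji] := eqVneq j i.
by have := congr1 (fun m : multinom n => m j) eq_d; rewrite !mnmE (negbTE ji).
Qed.

Definition set_one : n.-tuple {mpoly k[n]} :=
  [tuple (if j == i then 1 else 'X_j) | j < n].

Lemma monomial_set_one m : 'X_[m] \mPo set_one = 'X_[mnm_drop m].
Proof.
rewrite comp_mpolyX [RHS]mpolyXE_id; apply: eq_bigr => j _.
by rewrite tnth_mktuple mnmE; case: eqP; rewrite ?expr1n ?expr0.
Qed.

(** Dehomogenizing a form loses nothing: the degree of a monomial together
    with its exponents away from i determines the exponent at i. *)
Lemma mcoeff_set_one d (F : {mpoly k[n]}) m :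
  F \is d.-homog -> mdeg m = d -> (F \mPo set_one)@_(mnm_drop m) = F@_m.
Proof.
move=> /dhomogP homF deg_m.
rewrite comp_mpolyEX raddf_sum big_seq (eq_bigr (fun m' => F@_m' * (m' == m)%:R)) /=.
  rewrite -big_seq [in RHS](mpolyE F) raddf_sum; apply: eq_bigr => m' _ /=.
  by rewrite mcoeffZ mcoeffX.
move=> m' m'F; rewrite monomial_set_one mcoeffZ mcoeffX.
suff -> : (mnm_drop m' == mnm_drop m) = (m' == m) by [].
apply/eqP/eqP => [eq_d|->//]; apply: mnm_drop_inj => //.
have : mdeg m' = mdeg m by rewrite deg_m; exact: homF.
by rewrite (mdeg_drop m) (mdeg_drop m') eq_d => /addIn.
Qed.

Variable v : 'I_n -> k.
Hypothesis vi : v i = 1.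

(** The affine chart x_i = 1 recentred at v: the i-th entry is the constant
    v i = 1, so the i-th variable does not occur in a dehomogenized polynomial.
    Keeping it as a dummy variable avoids a change of the ring. *)
Definition chart : n.-tuple {mpoly k[n]} :=
  [tuple (v j)%:MP + (j != i)%:R *: 'X_j | j < n].

Definition unchart : n.-tuple {mpoly k[n]} :=
  [tuple 'X_j - (v j)%:MP | j < n].

Lemma chartK p : (p \mPo chart) \mPo unchart = p \mPo set_one.
Proof.
rewrite comp_mpoly_comp; congr (_ \mPo _); apply: eq_from_tnth => j.
rewrite !tnth_mktuple raddfD /= comp_mpolyC linearZ /= comp_mpolyXU -tnth_nth tnth_mktuple.
by case: eqP => [->|_] /=; rewrite ?vi ?scale0r ?addr0 ?mpolyC1 // scale1r addrC subrK.
Qed.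

Definition supp_le m (p : {mpoly k[n]}) := {in msupp p, forall m', lem m' m}.

Lemma supp_leM m1 m2 p1 p2 :
  supp_le m1 p1 -> supp_le m2 p2 -> supp_le (m1 + m2)%MM (p1 * p2).
Proof.
move=> h1 h2 m /msuppM_le /allpairsP[[a b] /= [/h1/mnm_lepP la /h2/mnm_lepP lb ->]].
by apply/mnm_lepP => j; rewrite !mnmDE leq_add.
Qed.

(** The chart substitution is triangular: expanding (v + y)^m only produces
    exponents below m, and none at the dummy variable. *)
Lemma supp_le_chart m : supp_le (mnm_drop m) ('X_[m] \mPo chart).
Proof.
have supp1 : supp_le 0%MM 1.
  by move=> m'; rewrite msupp1 inE => /eqP ->; exact: lepm_refl.
have suppj j : supp_le (mnm_drop (mnm1 j)) (tnth chart j).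
  move=> m'; rewrite tnth_mktuple => /msuppD_le; rewrite mem_cat => /orP[].
    rewrite msuppC; case: eqP => //= _; rewrite inE => /eqP ->.
    by apply/mnm_lepP => l; rewrite mnm0E.
  have [_|ji] := eqVneq j i; first by rewrite scale0r msupp0.
  rewrite scale1r msuppX inE => /eqP ->; apply/mnm_lepP => l.
  rewrite [leqRHS]mnmE; have [->|//] := eqVneq l i.
  by rewrite mnmE (negbTE ji).
have drop0 : mnm_drop 0%MM = 0%MM by apply/mnmP => j; rewrite !mnmE if_same.
have dropD m1 m2 : mnm_drop (m1 + m2)%MM = (mnm_drop m1 + mnm_drop m2)%MM.
  by apply/mnmP => j; rewrite !mnmE; case: eqP.
rewrite [m in 'X_[m]]multinomUE_id [m in mnm_drop m]multinomUE_id.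
rewrite -mprodXE rmorph_prod /=.
elim: (index_enum _) => [|j s IHs]; first by rewrite !big_nil drop0.
rewrite !big_cons dropD; apply: supp_leM => //.
elim: (m j) => [|e IHe]; first by rewrite mulm0n drop0 mpolyX0 rmorph1.
rewrite mulmS mpolyXD rmorphM dropD; apply: supp_leM => //.
by rewrite /= comp_mpolyXU -tnth_nth; exact: suppj.
Qed.

End Chart.

(** * Local description of the powers of the ideal of a point *)

Section LocalMultiplicity.

Variables (k : fieldType) (n : nat) (Q : projective_space k n).

Lemma exists_chart_vector :
  exists (v : 'rV[k]_n.+1) (i : 'I_n.+1), v \in val Q /\ v ord0 i = 1.
Proof.
have nz : vpick (val Q) != 0 by rewrite vpick0 -dimv_eq0 (eqP (valP Q)).
have /matrix0Pn[a [i]] := nz; rewrite (ord1 a) => nz_i.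
exists ((vpick (val Q) ord0 i)^-1 *: vpick (val Q)), i.
by rewrite rpredZ ?memv_pick // mxE mulVf.
Qed.

Variables (v : 'rV[k]_n.+1) (i : 'I_n.+1).
Hypotheses (vQ : v \in val Q) (vi : v ord0 i = 1).

Let v_neq0 : v != 0.
Proof. by apply: contra_eqN vi => /eqP ->; rewrite mxE eq_sym oner_eq0. Qed.

Lemma line_chart_vector u : u \in val Q -> u = u ord0 i *: v.
Proof.
have -> : val Q = <[v]>%VS.
  apply/esym/eqP; rewrite eqEdim -memvE vQ dim_vline v_neq0.
  by rewrite (eqP (valP Q)).
by move=> /vlineP[c ->]; rewrite mxE vi mulr1.
Qed.

(** These linear forms generate the ideal of Q; the i-th one is zero. *)
Definition tangent_form (j : 'I_n.+1) : {mpoly k[n.+1]} := 'X_j - v ord0 j *: 'X_i.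

Lemma tangent_form_vanishes j : vanishing_ideal [set Q] (tangent_form j).
Proof.
move=> _ -> u uQ _; rewrite /tangent_form mevalB mevalZ !mevalXU.
by rewrite {1}(line_chart_vector uQ) mxE mulrC subrr.
Qed.

Lemma mcoeff0_chart f :
  (f \mPo chart i (v ord0))@_0%MM = meval (v ord0) f.
Proof.
rewrite comp_mpolyE mevalE raddf_sum; apply: eq_bigr => m _ /=.
rewrite mcoeffZ rmorph_prod; congr (_ * _); apply: eq_bigr => j _ /=.
rewrite rmorphXn tnth_mktuple /= mcoeffD mcoeffZ mcoeffC mcoeffX mnm1_eq0 eqxx.
by rewrite mulr0 addr0 mulr1.
Qed.

(** A polynomial vanishing at Q has no constant term in the chart, so a product
    of r of them has order at least r. *)
Lemma ideal_power_order r f :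
  ideal_power (vanishing_ideal [set Q]) r f -> order_ge r (f \mPo chart i (v ord0)).
Proof.
move=> [N [c [g [Jg ->]]]]; rewrite raddf_sum; apply: order_ge_sum => j /=.
rewrite rmorphM rmorph_prod.
apply: (@order_ge_leq _ _ (0 + \sum_(a < r) 1)).
  by rewrite sum1_card card_ord.
apply: order_geM => //.
apply: order_ge_prod => a m; rewrite ltnS leqn0 mdeg_eq0 => /eqP ->.
by rewrite mcoeff0_chart; apply: Jg.
Qed.

(* A linear change of coordinates moving Q to the i-th coordinate point, and
   its inverse; followed by x_i := 1, the former is the chart. *)
Let rotate : n.+1.-tuple {mpoly k[n.+1]} :=
  [tuple (j != i)%:R *: 'X_j + v ord0 j *: 'X_i | j < n.+1].
Let unrotate : n.+1.-tuple {mpoly k[n.+1]} :=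
  [tuple (if j == i then 'X_i else tangent_form j) | j < n.+1].

Let rotateK f : (f \mPo rotate) \mPo unrotate = f.
Proof.
rewrite comp_mpoly_comp -[RHS]comp_mpoly_id; congr (_ \mPo _).
apply: eq_from_tnth => j; rewrite !tnth_mktuple raddfD /= !linearZ /=.
rewrite !comp_mpolyXU -!tnth_nth !tnth_mktuple eqxx.
by case: eqP => [->|_] /=; rewrite ?vi ?scale0r ?add0r scale1r // subrK.
Qed.

Let rotate_set_one f : (f \mPo rotate) \mPo set_one k i = f \mPo chart i (v ord0).
Proof.
rewrite comp_mpoly_comp; congr (_ \mPo _).
apply: eq_from_tnth => j; rewrite !tnth_mktuple raddfD /= !linearZ /=.
rewrite !comp_mpolyXU -!tnth_nth !tnth_mktuple eqxx addrC -mul_mpolyC mulr1.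
by case: eqP => //= _; rewrite !scale0r.
Qed.

Let rotate_homog d f : f \is d.-homog -> f \mPo rotate \is d.-homog.
Proof.
move=> homf; rewrite comp_mpolyE big_seq; apply: rpred_sum => m mf.
apply: rpredZ; have <- : mdeg m = d by move/dhomogP: homf; apply.
rewrite mdegE.
elim: (index_enum _) => [|j s IHs]; first by rewrite !big_nil; exact: dhomog1.
rewrite !big_cons; apply: dhomogM => //.
have homj : tnth rotate j \is 1.-homog.
  by rewrite tnth_mktuple; apply: rpredD; apply: rpredZ; rewrite dhomogX /= mdeg1.
by have := dhomogMn (m j) homj; rewrite mul1n.
Qed.

(** In coordinates where Q is the i-th coordinate point, the coefficients of a
    form are those of its dehomogenization; if these vanish below degree r in
    the other coordinates, every remaining monomial contains r of the linear
    forms vanishing at Q. *)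
Lemma order_ideal_power d r f : f \is d.-homog ->
  order_ge r (f \mPo chart i (v ord0)) -> ideal_power (vanishing_ideal [set Q]) r f.
Proof.
move=> homf ord_f; rewrite -[f]rotateK comp_mpolyE big_seq; apply: ideal_power_sum => m mf.
have deg_m : mdeg m = d by move/dhomogP: (rotate_homog homf); apply.
rewrite -mul_mpolyC; apply: ideal_powerMl.
have [lt_m|le_m] := ltnP (mdeg (mnm_drop i m)) r.
  have := ord_f _ lt_m; rewrite -rotate_set_one (mcoeff_set_one i (rotate_homog homf) deg_m).
  by move=> /eqP; rewrite mcoeff_eq0 mf.
rewrite (bigD1 i) //=; apply: ideal_powerMl.
rewrite (eq_bigr (fun j => tangent_form j ^+ mnm_drop i m j)) => [|j /negbTE ji].
  rewrite -big_filter; apply: ideal_power_prodX; first exact: tangent_form_vanishes.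
  move: le_m; rewrite mdegE (bigD1 i) //= {1}mnmE eqxx add0n big_filter; exact.
by rewrite tnth_mktuple mnmE ji.
Qed.

End LocalMultiplicity.

(** * The decomposition of a form over the q-th powers *)

Lemma expr_sum_pchar (A : comNzRingType) q I (s : seq I) (P : pred I) (F : I -> A) :
  [pchar A].-nat q -> (\sum_(i <- s | P i) F i) ^+ q = \sum_(i <- s | P i) F i ^+ q.
Proof.
move=> hq; apply: (big_morph (fun x => x ^+ q)); first by move=> x y; exact: exprDn_pchar.
by rewrite expr0n; case: q hq.
Qed.

Lemma mcoeff_sum_msupp (R : comNzRingType) n (p : {mpoly R[n]}) m :
  \sum_(m' <- msupp p) p@_m' * (m' == m)%:R = p@_m.
Proof.
rewrite [in RHS](mpolyE p) raddf_sum; apply: eq_bigr => m' _ /=.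
by rewrite mcoeffZ mcoeffX.
Qed.

Section DivMod.

Variables (n q : nat).

Definition mnm_div (m : multinom n) := [mnm (m j %/ q) | j < n].
Definition mnm_mod (m : multinom n) := [mnm (m j %% q) | j < n].

Lemma mnm_divmod m : m = (mnm_div m *+ q + mnm_mod m)%MM.
Proof. by apply/mnmP => j; rewrite mnmDE mulmnE !mnmE -divn_eq. Qed.

Lemma mdeg_divmod m : mdeg m = (q * mdeg (mnm_div m) + mdeg (mnm_mod m))%N.
Proof. by rewrite {1}(mnm_divmod m) mdegD mdegMn mulnC. Qed.

(** Uniqueness of Euclidean division, entry by entry; it makes the monomials
    with exponents below q linearly independent over the q-th powers. *)
Lemma mnm_divmod_eq (a b c d : multinom n) :
  (forall j, (b j < q)%N) -> (forall j, (d j < q)%N) ->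
  ((a *+ q + b)%MM == (c *+ q + d)%MM) = (a == c) && (b == d).
Proof.
move=> lt_b lt_d; apply/eqP/andP => [eq_m|[/eqP-> /eqP->]//].
have eqj j : (a j = c j /\ b j = d j)%N.
  have := congr1 (fun m : multinom n => m j) eq_m; rewrite !mnmDE !mulmnE => e.
  have q_gt0 : (0 < q)%N by exact: leq_ltn_trans (lt_b j).
  split; last by have := congr1 (modn^~ q) e; rewrite !modnMDl !modn_small.
  by have := congr1 (divn^~ q) e; rewrite !divnMDl // !divn_small // !addn0.
by split; apply/eqP/mnmP => j; case: (eqj j).
Qed.

Lemma ltn_mnm_mod m j : (0 < q)%N -> (mnm_mod m j < q)%N.
Proof. by move=> q_gt0; rewrite mnmE ltn_mod. Qed.

End DivMod.

Section FrobeniusParts.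

Variables (k : fieldType) (n q : nat).
Hypothesis q_char : [pchar k].-nat q.

Variable root : k -> k.
Hypothesis rootK : forall a, root a ^+ q = a.

Let q_gt0 : (0 < q)%N. Proof. by case: q q_char. Qed.

Let q_char_mpoly : [pchar {mpoly k[n]}].-nat q.
Proof. by rewrite (eq_pnat _ (pchar_lalg _)). Qed.

(** Since H ^+ q only has exponents divisible by q, no two terms of H and K
    contribute to the same monomial of the product. *)
Lemma mcoeff_expM (H K : {mpoly k[n]}) (b c : multinom n) :
  {in msupp K, forall (m : multinom n) j, (m j < q)%N} -> (forall j, (c j < q)%N) ->
  (H ^+ q * K)@_(b *+ q + c)%MM = H@_b ^+ q * K@_c.
Proof.
move=> ltK lt_c.
rewrite -[H@_b]mcoeff_sum_msupp -[K@_c]mcoeff_sum_msupp.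
rewrite (expr_sum_pchar _ _ _ q_char) {1}(mpolyE H) {1}(mpolyE K).
rewrite (expr_sum_pchar _ _ _ q_char_mpoly) !mulr_suml raddf_sum; apply: eq_bigr => m _ /=.
rewrite !mulr_sumr raddf_sum big_seq [RHS]big_seq; apply: eq_bigr => m' m'K /=.
rewrite exprZn mpolyXn -scalerAl -scalerAr -mpolyXD !mcoeffZ mcoeffX.
rewrite mnm_divmod_eq // ?exprMn; last exact: ltK.
by case: eqP => _ /=; rewrite ?expr1n ?mulr1 // expr0n eqn0Ngt q_gt0 /= !mulr0 mul0r.
Qed.

(** The coordinate of f along the basis element 'X_[l] over the ring of q-th
    powers, after extraction of the q-th root. *)
Definition frob_part (l : multinom n) (f : {mpoly k[n]}) : {mpoly k[n]} :=
  \sum_(m <- msupp f | mnm_mod q m == l) root f@_m *: 'X_[mnm_div q m].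

Lemma frob_part_homog l d e f :
  f \is d.-homog -> d = (q * e + mdeg l)%N -> frob_part l f \is e.-homog.
Proof.
move=> /dhomogP homf def_d; rewrite /frob_part big_seq_cond.
apply: rpred_sum => m /andP[mf /eqP def_l].
apply: rpredZ; rewrite dhomogX /=; apply/eqP.
have : mdeg m = d by exact: homf.
by rewrite (mdeg_divmod q) def_l def_d => /addIn /eqP; rewrite eqn_pmul2l // => /eqP.
Qed.

Lemma frob_part_neq0 f m : m \in msupp f -> frob_part (mnm_mod q m) f != 0.
Proof.
move=> mf; apply/negP => /eqP /(congr1 (mcoeff (mnm_div q m))); rewrite mcoeff0.
rewrite raddf_sum -big_filter (bigD1_seq m) /=; first last.
- by rewrite filter_uniq ?msupp_uniq.
- by rewrite mem_filter eqxx.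
rewrite mcoeffZ mcoeffX eqxx mulr1 big_filter_cond.
rewrite big1 ?addr0 => [rt0|m' /andP[/eqP eq_m ne_m]].
  by move: mf; rewrite mcoeff_msupp -(rootK f@_m) rt0 expr0n eqn0Ngt q_gt0 eqxx.
rewrite mcoeffZ mcoeffX; case: eqP => [eq_d|]; last by rewrite mulr0.
by move: ne_m; rewrite (mnm_divmod q m') eq_m eq_d -mnm_divmod eqxx.
Qed.

Variables (i : 'I_n) (v : 'I_n -> k).
Hypothesis vi : v i = 1.

(** Write th for the chart substitution, and P for the sum of the terms
    g_l`b ^ q * th 'X_[l], where g_l`b is the coefficient at b of th applied to
    the l-th part.  The exponents of P are below q, so its coefficient at e is
    that of th f at q * b + e; as the degree of P is at most B, the order of
    th f forces P = 0.  Undoing the translation, the monomials 'X_[l] with the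
    i-th variable set to 1 satisfy a linear relation with coefficients
    g_l`b ^ q.  By homogeneity the i-th entry of l is determined modulo q by the
    others, so these monomials are distinct and all g_l`b vanish. *)
Lemma frob_part_order d N B l f b :
  f \is d.-homog -> order_ge N (f \mPo chart i v) ->
  {in msupp f, forall m, (mdeg (mnm_drop i (mnm_mod q m)) <= B)%N} ->
  (q * mdeg b + B < N)%N -> (frob_part l f \mPo chart i v)@_b = 0.
Proof.
move=> /dhomogP homf ord_f bound_f lt_N.
pose th (m : multinom n) : {mpoly k[n]} := 'X_[m] \mPo chart i v.
(* c m is what the monomial m of f contributes at the exponents q * b + e, up to
   the coefficient at e of the residual factor th (mnm_mod q m). *)
pose c m := f@_m * (th (mnm_div q m))@_b ^+ q.
have lt_th m m' j : m' \in msupp (th (mnm_mod q m)) -> (m' j < q)%N.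
  move=> /supp_le_chart /mnm_lepP /(_ j) /leq_ltn_trans; apply; rewrite mnmE.
  by case: eqP => // _; exact: ltn_mnm_mod.
pose P := \sum_(m <- msupp f) c m *: th (mnm_mod q m).
have P0 : P = 0.
  apply/mpolyP => e; rewrite mcoeff0 raddf_sum /=.
  have [/andP[/forallP lt_e le_e]|small] := boolP ([forall j, e j < q] && (mdeg e <= B))%N.
    have coef0 : (f \mPo chart i v)@_(b *+ q + e)%MM = 0.
      by apply: ord_f; rewrite mdegD mdegMn; lia.
    rewrite -[RHS]coef0 comp_mpolyEX raddf_sum; apply: eq_bigr => m _ /=.
    have th_divmod : th m = th (mnm_div q m) ^+ q * th (mnm_mod q m).
      by rewrite /th {1}(mnm_divmod q m) mpolyXD -mpolyXn rmorphM rmorphXn.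
    rewrite !mcoeffZ -/(th m) th_divmod mcoeff_expM ?mulrA // => m' m'_th j.
    exact: lt_th m'_th.
  rewrite big_seq big1 // => m mf; rewrite mcoeffZ memN_msupp_eq0 ?mulr0 //.
  apply: contra small => em; apply/andP; split.
    by apply/forallP => j; exact: lt_th em.
  apply: leq_trans (bound_f m mf); rewrite !mdegE; apply: leq_sum => j _.
  by have /mnm_lepP := supp_le_chart em.
(* The inverse translation turns th 'X_[l] back into the monomial 'X_[l] with
   its i-th variable set to 1. *)
have sum0 (e : multinom n) :
    \sum_(m <- msupp f) c m * (mnm_drop i (mnm_mod q m) == mnm_drop i e)%:R = 0.
  have := congr1 (fun p => (p \mPo unchart v)@_(mnm_drop i e)) P0.
  rewrite /= /P (raddf_sum (comp_mpoly _)) comp_mpoly0 mcoeff0 raddf_sum => sumP.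
  rewrite -[RHS]sumP; apply: eq_bigr => m _ /=.
  by rewrite linearZ mcoeffZ /= chartK // monomial_set_one mcoeffX.
have [/hasP[m0 m0f /eqP def_l]|no_m] :=
    boolP (has (fun m => mnm_mod q m == l) (msupp f)); last first.
  rewrite /frob_part big_seq_cond big_pred0 ?comp_mpoly0 ?mcoeff0 // => m.
  by apply/negP => /andP[mf ml]; case/hasP: no_m; exists m.
have mod_inj m : m \in msupp f ->
    (mnm_drop i (mnm_mod q m) == mnm_drop i l) = (mnm_mod q m == l).
  move=> mf; apply/eqP/eqP => [eq_d|->//]; apply: (mnm_drop_inj eq_d).
  have : mdeg m = mdeg m0 by rewrite (homf _ mf) (homf _ m0f).
  rewrite (mdeg_divmod q m) (mdeg_divmod q m0) !(mdeg_drop i (mnm_mod q _)) def_l eq_d.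
  rewrite !addnA => /addIn /(congr1 (modn^~ q)); rewrite !(mulnC q) !modnMDl.
  by rewrite -def_l !mnmE !modn_mod.
suff: (frob_part l f \mPo chart i v)@_b ^+ q == 0 by rewrite expf_eq0 q_gt0 => /eqP.
apply/eqP; rewrite -[RHS](sum0 l) /frob_part (raddf_sum (comp_mpoly _)) raddf_sum.
rewrite (expr_sum_pchar _ _ _ q_char) big_mkcond big_seq [RHS]big_seq.
apply: eq_bigr => m mf /=.
rewrite mod_inj // linearZ mcoeffZ exprMn rootK /c.
by case: eqP => _; rewrite ?mulr1 ?mulr0.
Qed.

End FrobeniusParts.

(** * Auxiliary facts on finite sequences and roots *)

Lemma exists_argmax_seq (T : eqType) (s : seq T) (F : T -> nat) :
  s != [::] -> exists2 x, x \in s & {in s, forall y, (F y <= F x)%N}.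
Proof.
elim: s => // a [|b s] IHs _; first by exists a; rewrite ?inE // => y; rewrite inE => /eqP ->.
have [//|x xs max_x] := IHs; have [le_ax|lt_xa] := leqP (F a) (F x).
  by exists x; [rewrite inE xs orbT | move=> y; rewrite inE => /orP[/eqP ->|/max_x]].
exists a; first by rewrite mem_head.
move=> y; rewrite inE => /orP[/eqP -> //|/max_x le_yx].
exact: leq_trans le_yx (ltnW lt_xa).
Qed.

Lemma closed_field_root (k : closedFieldType) q :
  (0 < q)%N -> exists root : k -> k, forall a, root a ^+ q = a.
Proof.
move=> q_gt0; have root_ex (a : k) : exists x, x ^+ q = a.
  have /closed_rootP[x] : size ('X^q - a%:P : {poly k}) != 1%N.
    by rewrite size_XnsubC // eqSS -lt0n.
  by rewrite /root !hornerE subr_eq0 => /eqP; exists x.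
by have [root rootK] := choice root_ex; exists root.
Qed.

(** * Forms vanishing to a given order along a set of points *)

Section Forms.

Variables (k : fieldType) (n : nat) (X : set (projective_space k n)).

Definition fat_form r d (f : {mpoly k[n.+1]}) : Prop :=
  [/\ f != 0, f \is d.-homog & symbolic_power X r f].

(** Charts make symbolic powers accessible: for forms, membership is an order
    condition at each point. *)
Lemma symbolic_power_order d r f : f \is d.-homog ->
  symbolic_power X r f <->
  forall Q, X Q -> forall (v : 'rV[k]_n.+1) i, v \in val Q -> v ord0 i = 1 ->
    order_ge r (f \mPo chart i (v ord0)).
Proof.
move=> homf; split=> [If Q XQ v i vQ vi|ordf Q XQ].
  by apply: ideal_power_order vQ vi _ _ _; exact: If.
have [v [i [vQ vi]]] := exists_chart_vector Q.
exact: (order_ideal_power vQ vi homf (ordf Q XQ v i vQ vi)).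
Qed.

Lemma fat_formM r s d e f g :
  fat_form r d f -> fat_form s e g -> fat_form (r + s) (d + e) (f * g).
Proof.
move=> [f0 homf If] [g0 homg Ig]; have homfg := dhomogM homf homg.
split=> //; first by rewrite mulf_neq0.
apply/(symbolic_power_order _ homfg) => Q XQ v i vQ vi; rewrite rmorphM.
apply: order_geM; first exact: (symbolic_power_order r homf).1 If Q XQ v i vQ vi.
exact: (symbolic_power_order s homg).1 Ig Q XQ v i vQ vi.
Qed.

Lemma fat_form_leq r s d f : (s <= r)%N -> fat_form r d f -> fat_form s d f.
Proof.
move=> le_sr [f0 homf If]; split=> //.
apply/(symbolic_power_order _ homf) => Q XQ v i vQ vi.
exact: order_ge_leq le_sr ((symbolic_power_order r homf).1 If Q XQ v i vQ vi).
Qed.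

Lemma fat_form1 : fat_form 0 0 1.
Proof.
split; [exact: oner_neq0 | exact: dhomog1 |].
by apply/(symbolic_power_order _ (dhomog1 _ _)) => Q XQ v i vQ vi m.
Qed.

Lemma fat_formX r d f e : fat_form r d f -> fat_form (r * e) (d * e) (f ^+ e).
Proof.
move=> hf; elim: e => [|e IHe]; first by rewrite !muln0; exact: fat_form1.
by rewrite !mulnS exprS; exact: fat_formM.
Qed.

(** A product of r-th powers of hyperplanes, one through each point; a
    hyperplane through a point exists because n > 0. *)
Lemma exists_fat_form r : (0 < n)%N -> finite_set X -> exists d f, fat_form r d f.
Proof.
move=> n_gt0 /finite_seqP[s def_X].
have lin Q : exists l : {mpoly k[n.+1]},
    [/\ l != 0, l \is 1.-homog & vanishing_ideal [set Q] l].
  have [v [i [vQ vi]]] := exists_chart_vector Q.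
  have [j ji] : exists j : 'I_n.+1, j != i.
    case: (unliftP ord0 i) => [i' ->|->]; first by exists ord0.
    by exists (lift ord0 (Ordinal n_gt0)).
  exists (tangent_form v i j); split; last exact: tangent_form_vanishes.
    apply/negP => /eqP /(congr1 (mcoeff (mnm1 j))); rewrite mcoeff0 mcoeffB mcoeffZ.
    rewrite !mcoeffX eqxx eq_mnm1 eq_sym (negbTE ji) mulr0 subr0.
    by move/eqP; rewrite oner_eq0.
  apply: rpredB; last apply: rpredZ; by rewrite dhomogX /= mdeg1.
have [l /all_and3[l0 l1 Il]] := choice lin.
exists (\sum_(Q <- s) 1 * r)%N, (\prod_(Q <- s) l Q ^+ r).
split.
- by rewrite prodf_seq_neq0; apply/allP => Q _; rewrite /= expf_neq0.
- elim: s {def_X} => [|Q s IHs]; first by rewrite !big_nil; exact: dhomog1.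
  by rewrite !big_cons; apply: dhomogM => //; exact: dhomogMn.
move=> Q; rewrite def_X /= => Qs.
by rewrite (big_rem Q) //= mulrC; apply: ideal_powerMl; exact: ideal_powerXn.
Qed.

Lemma initial_degree_leq r d f :
  fat_form r d f -> (initial_degree (symbolic_power X r) <= d)%N.
Proof.
move=> [f0 homf If]; rewrite /initial_degree; case: xgetP => [e _ [_ min_e]|//].
by apply: min_e; exists f.
Qed.

Lemma initial_degree_attained r d f : fat_form r d f ->
  exists g, fat_form r (initial_degree (symbolic_power X r)) g.
Proof.
move=> hf; have ex : exists e, `[< exists g, fat_form r e g >].
  by exists d; apply/asboolP; exists f.
case: (ex_minnP ex) => e /asboolP[g [g0 homg Ig]] min_e.
suff [[h [Ih homh] h0] _] : [set e | nonzero_degrees (symbolic_power X r) e /\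
    forall e', nonzero_degrees (symbolic_power X r) e' -> (e <= e')%N]
    (initial_degree (symbolic_power X r)) by exists h.
apply: xgetPex; exists e; split; first by exists g.
by move=> e' [h [Ih homh] h0]; apply: min_e; apply/asboolP; exists h.
Qed.

End Forms.

(** * Growth of the initial degree *)

Section PositiveCharacteristic.

Variables (k : closedFieldType) (p n : nat).
Hypothesis p_char : p \in [pchar k].
Variable X : set (projective_space k n).
Hypothesis X_neq0 : X !=set0.

Let p_prime : prime p. Proof. exact: pcharf_prime p_char. Qed.

(** A constant vanishing at a point is zero. *)
Lemma fat_form_degree_gt0 r d f : fat_form X r.+1 d f -> (0 < d)%N.
Proof.
move=> [f0 homf If]; rewrite lt0n; apply/negP => /eqP d0; subst d.
have [Q XQ] := X_neq0; have [v [i [vQ vi]]] := exists_chart_vector Q.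
have := (symbolic_power_order X r.+1 homf).1 If Q XQ v i vQ vi 0%MM.
have def_f : f = (f@_0%MM)%:MP.
  apply/mpolyP => m; rewrite mcoeffC.
  have [->|nz_m] := eqVneq m 0%MM; first by rewrite mulr1.
  by rewrite mulr0 (dhomog_nemf_coeff homf) // mdeg_eq0.
rewrite mdeg0 mcoeff0_chart def_f mevalC => /(_ isT) c0.
by move: f0; rewrite def_f c0 mpolyC0 eqxx.
Qed.

(** The replacement for differentiation.  If every derivative of f is zero,
    then f = g ^+ p; for r = p * u + w with w < p, the form g has order at least
    u + 1, induction on the degree gives h of degree deg g - 1 and order u, and
    g ^+ p.-1 * h has degree d - 1 and order (u + 1) * (p - 1) + u >= r. *)
Lemma descend_fat_form r d f :
  fat_form X r.+1 d f -> exists g, fat_form X r d.-1 g.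
Proof.
have [l] := ubnP d; elim: l d r f => // l IHl d r f lt_d hf.
have d_gt0 := fat_form_degree_gt0 hf; have [f0 homf If] := hf.
(* A non-zero derivative has the required order.  If there is none, all
   exponents of f are divisible by p, and f has a single part. *)
have [/forallP no_deriv|] := boolP [forall j, f^`M(j) == 0]; last first.
  rewrite negb_forall => /existsP[j fj]; exists f^`M(j); split=> // [|Q XQ]; last first.
    by apply: ideal_power_deriv; exact: If.
  apply/dhomogP => m; rewrite mcoeff_msupp mcoeff_mderiv => fm.
  have : (m + mnm1 j)%MM \in msupp f.
    by rewrite mcoeff_msupp; apply: contraNneq fm => ->; rewrite mul0rn.
  by move/(dhomogP _ _ _ homf); rewrite /= mdegD mdeg1 addn1 => <-.
have mod_f : {in msupp f, forall m, mnm_mod p m = 0%MM}.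
  move=> m mf; apply/mnmP => j; rewrite mnmE mnm0E; apply/eqP; rewrite -/(dvdn p (m j)).
  case def_j: (m j) => [|a]; first exact: dvdn0.
  have le_j : lem (mnm1 j) m by rewrite lep1mP def_j.
  have := congr1 (mcoeff (mnm_sub m (mnm1 j))) (eqP (no_deriv j)).
  rewrite mcoeff0 mcoeff_mderiv submK // mnmBE mnm1E eqxx def_j subn1 /=.
  by move/eqP; rewrite -mulr_natr mulf_eq0 mcoeff_eq0 mf /= -(dvdn_pcharf p_char).
have [root rootK] := @closed_field_root k p (prime_gt0 p_prime).
have p_nat : [pchar k].-nat p by rewrite pnatE.
pose g := frob_part p root 0%MM f.
have [m0 m0f] : exists m0, m0 \in msupp f.
  case def_s: (msupp f) => [|m s]; first by move: f0; rewrite -msupp_eq0 def_s.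
  by exists m; rewrite mem_head.
have deg_m0 : mdeg m0 = d by move/dhomogP: homf; apply.
set e := mdeg (mnm_div p m0).
have def_d : d = (p * e)%N.
  by rewrite -deg_m0 (mdeg_divmod p m0) (mod_f _ m0f) mdeg0 addn0.
have hg : fat_form X (r %/ p).+1 e g.
  have homg : g \is e.-homog.
    by apply: (frob_part_homog p_nat _ homf); rewrite mdeg0 addn0.
  split=> //; first by rewrite /g -(mod_f _ m0f); exact: frob_part_neq0.
  apply/(symbolic_power_order X _ homg) => Q XQ v i vQ vi b; rewrite ltnS => le_b.
  apply: (@frob_part_order _ _ _ p_nat _ rootK i _ vi d r.+1 0 0%MM f) => //.
  - exact: (symbolic_power_order X r.+1 homf).1 If Q XQ v i vQ vi.
  - move=> m mf; rewrite mod_f // mdegE big1 // => j _.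
    by rewrite mnmE mnm0E if_same.
  by rewrite addn0 ltnS mulnC -leq_divRL // prime_gt0.
have e_gt0 := fat_form_degree_gt0 hg.
have p_gt1 := prime_gt1 p_prime.
have lt_el : (e < l)%N by nia.
have [h hh] := IHl e (r %/ p)%N g lt_el hg.
exists (g ^+ p.-1 * h).
have -> : d.-1 = (e * p.-1 + e.-1)%N by nia.
apply: fat_form_leq (fat_formM (fat_formX p.-1 hg) hh).
have := ltn_pmod r (prime_gt0 p_prime); have := divn_eq r p; nia.
Qed.

Hypotheses (n_gt0 : (0 < n)%N) (X_fin : finite_set X).

Let alpha r := initial_degree (symbolic_power X r).

Lemma fat_form_initial_degree r : exists f, fat_form X r (alpha r) f.
Proof.
have [d [f hf]] := exists_fat_form r n_gt0 X_fin.
exact: initial_degree_attained hf.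
Qed.

Lemma initial_degree_addr r s : (alpha r + s <= alpha (r + s))%N.
Proof.
elim: s => [|s IHs]; first by rewrite !addn0.
rewrite !addnS; have [f hf] := fat_form_initial_degree (r + s).+1.
have := fat_form_degree_gt0 hf; have [g /initial_degree_leq] := descend_fat_form hf.
by move: IHs; rewrite /alpha; lia.
Qed.

(** The main inequality; see the discussion at the top.  Both cases there are
    treated at once with t = minn (M %/ q) n.-1 and B = minn M (n * q.-1). *)
Lemma initial_degree_pchar_power e m : (0 < m)%N ->
  (p ^ e * (alpha m + n.-1) <= alpha (p ^ e * (m + n.-1)))%N.
Proof.
move=> m_gt0; set q := (p ^ e)%N.
have q_gt0 : (0 < q)%N by rewrite expn_gt0 prime_gt0.
have q_nat : [pchar k].-nat q by rewrite pnatX pnatE ?p_char.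
have [root rootK] := @closed_field_root k q q_gt0.
have [f [f0 homf If]] := fat_form_initial_degree (q * (m + n.-1)).
have [m0 m0f max_m0] : exists2 m0, m0 \in msupp f &
    {in msupp f, forall m', (mdeg (mnm_mod q m') <= mdeg (mnm_mod q m0))%N}.
  by apply: exists_argmax_seq; rewrite msupp_eq0.
set M := mdeg (mnm_mod q m0) in max_m0; set d' := mdeg (mnm_div q m0).
have def_d : alpha (q * (m + n.-1)) = (q * d' + M)%N.
  by rewrite -mdeg_divmod; apply/esym; move/dhomogP: homf; apply.
pose t := minn (M %/ q) n.-1.
have hg : fat_form X (m + (n.-1 - t)) d' (frob_part q root (mnm_mod q m0) f).
  have homg := frob_part_homog q_nat root homf def_d.
  split=> //; first exact: frob_part_neq0.
  apply/(symbolic_power_order X _ homg) => Q XQ v i vQ vi b lt_b.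
  apply: (@frob_part_order _ _ _ q_nat _ rootK i _ vi _
    (q * (m + n.-1)) (minn M (n * q.-1)) _ f _ homf) => //.
  - exact: (symbolic_power_order X _ homf).1 If Q XQ v i vQ vi.
  - move=> m' m'f; rewrite leq_min; apply/andP; split.
      by apply: leq_trans (max_m0 _ m'f); rewrite (mdeg_drop i (mnm_mod q m')) leq_addl.
    rewrite mdegE (bigD1 i) //= {1}mnmE eqxx add0n.
    rewrite -[X in (X * _)%N](_ : #|predC1 i| = n); last by rewrite cardC1 card_ord.
    rewrite -sum_nat_const; apply: leq_sum => j _.
    rewrite mnmE; case: eqP => // _; rewrite -ltnS prednK //; exact: ltn_mnm_mod.
  have M_divq := divn_eq M q; have M_modq := ltn_pmod M q_gt0.
  move: lt_b; rewrite /t; have [le_n|lt_n] := leqP n.-1 (M %/ q); last first.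
    have := geq_minl M (n * q.-1); nia.
  have := geq_minr M (n * q.-1); nia.
have := initial_degree_addr m (n.-1 - t); have := initial_degree_leq hg.
rewrite -/(alpha _) def_d => le1 le2.
have le_t : (t <= n.-1)%N by rewrite geq_minr.
have le_M : (q * t <= M)%N.
  by rewrite mulnC -leq_divRL // geq_minl.
nia.
Qed.

End PositiveCharacteristic.

(** * Fekete's lemma *)

Section Fekete.

Variables (R : realType) (a : nat -> nat).
Hypothesis a_subadd : forall r s, (a (r + s) <= a r + a s)%N.

Lemma subadditive_mul r t s : (a (r * t + s) <= t * a r + a s)%N.
Proof.
elim: t => [|t IHt]; first by rewrite muln0 add0n mul0n.
by rewrite mulnS mulSn -!addnA (leq_trans (a_subadd _ _)) // leq_add2l.
Qed.

Let rate r : R := (a r)%:R / r%:R.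

(** Fekete's lemma: the limit is the infimum, because writing l = r * t + s with
    s < r gives a l / l <= a r / r + C / l, where C bounds the a s. *)
Lemma subadditive_rate_cvg : cvgn rate.
Proof.
pose E : set R := [set rate r.+1 | r in setT].
have E_inf : has_inf E.
  by split; [exists (rate 1), 0%N | exists 0 => _ [r _ <-]; rewrite /rate divr_ge0].
apply/cvg_ex; exists (inf E); apply/cvgrPdist_lt => eps eps_gt0.
have eps2 : 0 < eps / 2 by rewrite divr_gt0.
have [_ [r _ <-] lt_r] := inf_adherent eps2 E_inf.
pose C := (\max_(s < r.+1) a s)%N.
pose N := (Num.trunc (C%:R / (eps / 2) : R)).+1.
exists N => //= l le_Nl; have l_gt0 : (0 < l)%N by exact: leq_ltn_trans le_Nl.
have l_gt0R : 0 < l%:R :> R by rewrite ltr0n.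
have ge_l : inf E <= rate l.
  by apply: ge_inf; [exact: E_inf.2 | exists l.-1; rewrite ?prednK].
rewrite ler0_norm ?subr_le0 // opprB ltrBlDl.
have lt_C : C%:R < l%:R * (eps / 2).
  rewrite -ltr_pdivrMr //; apply: lt_le_trans (truncnS_gt _) _.
  by rewrite ler_nat.
apply: (@lt_trans _ _ (rate r.+1 + eps / 2)); last by lra.
rewrite /rate ltr_pdivrMr // mulrDl.
have : (a l <= (l %/ r.+1) * a r.+1 + C)%N.
  rewrite {1}(divn_eq l r.+1) mulnC; apply: leq_trans (subadditive_mul _ _ _) _.
  rewrite leq_add2l.
  exact: (@leq_bigmax _ (fun s : 'I_r.+1 => a s) (Ordinal (ltn_pmod l (ltn0Sn r)))).
rewrite -(ler_nat R) natrD natrM => le_al; apply: le_lt_trans le_al _.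
apply: ler_ltD; last by rewrite mulrC.
rewrite mulrAC -mulrA mulrC ler_wpM2l // ler_pdivlMr ?ltr0n //.
by rewrite -natrM ler_nat leq_trunc_div.
Qed.

End Fekete.

(** * The lower bound *)

(** A limit below the bound would put alpha r / r below it for all large r, in
    particular for some r = p ^ N * (m + n - 1). *)
Theorem theorem1p1 (R : realType) (k : closedFieldType) (p : nat)
    (hp : p \in [pchar k]) (n : nat) (hn : (1 <= n)%N)
    (X : set (projective_space k n)) (X_fin : finite_set X) (X_neq0 : X !=set0)
    (m : nat) (hm : (1 <= m)%N) :
  waldschmidt_constant R X >=
    ((initial_degree (symbolic_power X m))%:R + n%:R - 1) / (m%:R + n%:R - 1).
Proof.
pose alpha r := initial_degree (symbolic_power X r).
have alpha_subadd r s : (alpha (r + s) <= alpha r + alpha s)%N.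
  have [f hf] := fat_form_initial_degree hn X_fin r.
  have [g hg] := fat_form_initial_degree hn X_fin s.
  exact: initial_degree_leq (fat_formM hf hg).
rewrite leNgt; apply/negP => /(cvgr_lt _ (@subadditive_rate_cvg R _ alpha_subadd)).
case=> N _ /= lt_rate.
have p_gt1 := prime_gt1 (pcharf_prime hp).
have pN_gt0 : (0 < p ^ N)%N by rewrite expn_gt0 ltnW.
have [m_gt0 n_gt0] : 0 < m%:R :> R /\ 1 <= n%:R :> R by rewrite ltr0n ler1n.
have den : (m + n.-1)%:R = m%:R + n%:R - 1 :> R.
  by rewrite -subn1 natrD natrB // addrA.
have num : (alpha m + n.-1)%:R = (alpha m)%:R + n%:R - 1 :> R.
  by rewrite -subn1 natrD natrB // addrA.
(* The index p ^ N * (m + n - 1) is beyond the threshold N because N < p ^ N. *)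
have le_N : (N <= p ^ N * (m + n.-1))%N.
  by rewrite (leq_trans (ltnW (ltn_expl _ p_gt1))) // leq_pmulr // addn_gt0 hm.
have := lt_rate _ le_N; apply/negP; rewrite -leNgt.
rewrite -den -num ler_pdivrMr ?ltr0n ?addn_gt0 ?hm // mulrAC.
rewrite ler_pdivlMr ?ltr0n ?muln_gt0 ?addn_gt0 ?hm ?pN_gt0 //.
rewrite -!natrM ler_nat mulnCA mulnA leq_pmul2r ?addn_gt0 ?hm //.
exact: (initial_degree_pchar_power hp X_neq0 hn X_fin N hm).
Qed.
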